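(* Let $n\ge 3$ and let $i,j,k\in\{1,\dots,n\}$ be distinct with $k>i$ and $k>j$. Then $w^p_{ijk}$ is an invariant for $G_{n,p}^3$; that is, if two words $\beta,\beta'$ in the generators of $G_{n,p}^3$ represent the same element of $G_{n,p}^3$, then $w^p_{ijk}(\beta)=w^p_{ijk}(\beta')$ in $F_n^3$.
   Context: **The group $G_{n,p}^3$.** It has generators $a_{xyz}^{\epsilon}$, where $\{x,y,z\}\subset\{1,\dots,n\}$ is a $3$-element subset (the order of $x,y,z$ is irrelevant) and $\epsilon\in\{0,1\}$ is a superscript label (not a power), subject to: (1) $(a_{xyz}^{\epsilon})^2=1$; (2) $(a_{xyz}^{\epsilon_1}a_{stu}^{\epsilon_2})^2=1$ if $|\{x,y,z\}\cap\{s,t,u\}|<2$, for arbitrary $\epsilon_1,\epsilon_2\in\{0,1\}$; (3) $(a_{xyz}^{\epsilon_v}a_{xyv}^{\epsilon_z}a_{xzv}^{\epsilon_y}a_{yzv}^{\epsilon_x})^2=1$ for distinct $x,y,z,v\in\{1,\dots,n\}$ and $\epsilon_x,\epsilon_y,\epsilon_z,\epsilon_v\in\{0,1\}$ such that $\sum_{s\in\{x,y,z,v\}\setminus\{t\}}\epsilon_s\equiv0\pmod2$, where $t=\max\{x,y,z,v\}$. **The group $F_n^3$.** For fixed $i,j,k$, $F_n^3$ is the group generated by all maps $\sigma:\{1,\dots,n\}\setminus\{i,j,k\}\to\mathbb{Z}_2$ with relations $\sigma^2=1$ for each $\sigma$. **The map $w^p_{ijk}$.** Let $\beta$ be a word in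 the generators of $G_{n,p}^3$ and let $c_1,\dots,c_m$ be, from left to right, all occurrences of letters $a_{ijk}^{\epsilon}$ ($\epsilon\in\{0,1\}$) in $\beta$. For an occurrence $c$ of $a_{ijk}^\epsilon$ and $l\in\{1,\dots,n\}\setminus\{i,j,k\}$ set $$i^p_{c}(l)=\begin{cases}N_{ikl}^0+N_{jkl}^0+N_{ijl}^1\bmod2&\text{if }\epsilon=0,\ l>k,\\ N_{ikl}^0+N_{jkl}^0\bmod2&\text{if }\epsilon=0,\ l<k,\\ N_{ikl}^0+N_{jkl}^1+N_{ijl}^0\bmod2&\text{if }\epsilon=1,\ l>k,\\ N_{ikl}^0+N_{jkl}^1\bmod2&\text{if }\epsilon=1,\ l<k,\end{cases}$$ where $N_{xyz}^{\delta}$ is the number of occurrences of $a_{xyz}^{\delta}$ before $c$ in $\beta$. Then $w^p_{ijk}(\beta)=i^p_{c_1}i^p_{c_2}\cdots i^p_{c_m}\in F_n^3$. *)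

(* Defs.v *)
From HB Require Import structures.
From mathcomp Require Import all_boot ssralg zmodp boolp.

Set Implicit Arguments.
Unset Strict Implicit.
Unset Printing Implicit Defensive.

(* The group < X | R >: words over the letters (x, true) = x and
   (x, false) = x^-1, modulo free reduction and the relators.  Relators are
   given as words in the generators without inverses, which is enough for the
   presentations considered here. *)
Section Presentation.
Variables (X : choiceType) (R : seq X -> Prop).

Definition pos_word (r : seq X) : seq (X * bool) := [seq (x, true) | x <- r].

Inductive pres_eq : seq (X * bool) -> seq (X * bool) -> Prop :=
| pres_refl u : pres_eq u u
| pres_sym u v : pres_eq u v -> pres_eq v u
| pres_trans u v w : pres_eq u v -> pres_eq v w -> pres_eq u w
| pres_cancel u v x b : pres_eq (u ++ [:: (x, b); (x, ~~ b)] ++ v) (u ++ v)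
| pres_relator u v r : R r -> pres_eq (u ++ pos_word r ++ v) (u ++ v).

Definition pres_eqb (u v : seq (X * bool)) : bool := `[< pres_eq u v >].

Lemma pres_eqb_refl : reflexive pres_eqb.
Proof. by move=> u; apply/asboolP; apply: pres_refl. Qed.

Lemma pres_eqb_sym : symmetric pres_eqb.
Proof. by move=> u v; apply/asboolP/asboolP => /pres_sym. Qed.

Lemma pres_eqb_trans : transitive pres_eqb.
Proof.
move=> v u w /asboolP uv /asboolP vw.
by apply/asboolP; apply: pres_trans vw.
Qed.

Canonical pres_equiv :=
  EquivRel pres_eqb pres_eqb_refl pres_eqb_sym pres_eqb_trans.

Definition presented : Type := {eq_quot pres_equiv}%qT.

HB.instance Definition _ := Choice.on presented.

Definition pres_class (u : seq (X * bool)) : presented := (\pi_{eq_quot pres_equiv} u)%qT.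

Lemma pres_classP u v : pres_class u = pres_class v <-> pres_eq u v.
Proof. by split=> [/eqquotP/asboolP|uv]; last by apply/eqquotP/asboolP. Qed.

Lemma pres_eq_cat2 u u' v v' :
  pres_eq u u' -> pres_eq v v' -> pres_eq (u ++ v) (u' ++ v').
Proof.
have catl t a b : pres_eq a b -> pres_eq (t ++ a) (t ++ b).
  elim=> [? | ? ? _ | ? ? ? _ ab _ | a' b' x c | a' b' r Rr].
  - exact: pres_refl.
  - exact: pres_sym.
  - exact: pres_trans.
  - by rewrite !(catA t); apply: pres_cancel.
  - by rewrite !(catA t); apply: pres_relator.
have catr t a b : pres_eq a b -> pres_eq (a ++ t) (b ++ t).
  elim=> [? | ? ? _ | ? ? ? _ ab _ | a' b' x c | a' b' r Rr].
  - exact: pres_refl.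
  - exact: pres_sym.
  - exact: pres_trans.
  - by rewrite -!catA; apply: pres_cancel.
  - by rewrite -!catA; apply: pres_relator.
by move=> uu' vv'; apply: pres_trans (catr _ _ _ uu') (catl _ _ _ vv').
Qed.

Definition inv_word (u : seq (X * bool)) : seq (X * bool) :=
  rev [seq (c.1, ~~ c.2) | c <- u].

Lemma inv_wordK : involutive inv_word.
Proof.
move=> u; rewrite /inv_word map_rev revK -map_comp -[RHS]map_id.
by apply: eq_map => -[x b] /=; rewrite negbK.
Qed.

Lemma pres_eq_invr u : pres_eq (u ++ inv_word u) [::].
Proof.
elim: u => [|[x b] u IHu]; first exact: pres_refl.
rewrite /inv_word /= rev_cons -cats1.
apply: (@pres_trans _ ([:: (x, b)] ++ [::] ++ [:: (x, ~~ b)])).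
  rewrite -(cat1s (x, b)) (catA u); apply: pres_eq_cat2 (pres_refl _) _.
  exact: pres_eq_cat2 IHu (pres_refl _).
exact: (pres_cancel [::] [::] x b).
Qed.

Lemma pres_eq_invl u : pres_eq (inv_word u ++ u) [::].
Proof. by rewrite -{2}[u]inv_wordK; apply: pres_eq_invr. Qed.

Lemma pres_eq_inv u v : pres_eq u v -> pres_eq (inv_word u) (inv_word v).
Proof.
move=> uv; apply: (@pres_trans _ (inv_word u ++ (v ++ inv_word v))).
  rewrite -{1}[inv_word u]cats0; apply: pres_eq_cat2 (pres_refl _) _.
  exact/pres_sym/pres_eq_invr.
rewrite catA -[X in pres_eq _ X]cat0s; apply: pres_eq_cat2 (pres_refl _).
apply: pres_trans (pres_eq_invl u).
exact: pres_eq_cat2 (pres_refl _) (pres_sym uv).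
Qed.

Definition pres_one : presented := pres_class [::].
Definition pres_mul (a b : presented) : presented :=
  pres_class (repr a ++ repr b).
Definition pres_inv (a : presented) : presented := pres_class (inv_word (repr a)).

Lemma pres_reprK (a : presented) : pres_class (repr a) = a.
Proof. exact: reprK. Qed.

Lemma pres_mulE u v :
  pres_mul (pres_class u) (pres_class v) = pres_class (u ++ v).
Proof.
by apply/pres_classP; apply: pres_eq_cat2; apply/pres_classP; rewrite pres_reprK.
Qed.

Lemma pres_invE u : pres_inv (pres_class u) = pres_class (inv_word u).
Proof.
by apply/pres_classP; apply: pres_eq_inv; apply/pres_classP; rewrite pres_reprK.
Qed.

Lemma pres_mulA : associative pres_mul.
Proof.
move=> a b c; rewrite -(pres_reprK a) -(pres_reprK b) -(pres_reprK c).
by rewrite !pres_mulE catA.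
Qed.

Lemma pres_mul1 : left_id pres_one pres_mul.
Proof. by move=> a; rewrite -(pres_reprK a) pres_mulE. Qed.

Lemma pres_mulr1 : right_id pres_one pres_mul.
Proof. by move=> a; rewrite -(pres_reprK a) pres_mulE cats0. Qed.

Lemma pres_mulV : left_inverse pres_one pres_inv pres_mul.
Proof.
move=> a; rewrite -(pres_reprK a) pres_invE pres_mulE.
exact/pres_classP/pres_eq_invl.
Qed.

Lemma pres_mulrV : right_inverse pres_one pres_inv pres_mul.
Proof.
move=> a; rewrite -(pres_reprK a) pres_invE pres_mulE.
exact/pres_classP/pres_eq_invr.
Qed.

HB.instance Definition _ := isGroup.Build presented
  pres_mulA pres_mul1 pres_mulr1 pres_mulV pres_mulrV.

Definition pres_gen (x : X) : presented := pres_class [:: (x, true)].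

Definition pres_eval (r : seq X) : presented := (\prod_(x <- r) pres_gen x)%g.

Lemma pres_evalE r : pres_eval r = pres_class (pos_word r).
Proof.
rewrite /pres_eval; elim: r => [|x r IHr]; first by rewrite big_nil.
by rewrite big_cons IHr -[LHS]/(pres_mul _ _) pres_mulE.
Qed.

End Presentation.

(* Indices 1, ..., n are represented by 'I_n = {0, ..., n-1}; only their order
   matters. *)

(* The generator a_{xyz}^eps is the pair ({x, y, z}, eps), with false and true
   for the labels 0 and 1. *)
Definition a_gen (n : nat) : choiceType :=
  {a : {set 'I_n} * bool | #|a.1| == 3}.

Definition a_supp n (c : a_gen n) : {set 'I_n} := (val c).1.
Definition a_label n (c : a_gen n) : bool := (val c).2.

Inductive Gnp3_rel (n : nat) : seq (a_gen n) -> Prop :=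
| Gnp3_sq (a : a_gen n) : Gnp3_rel [:: a; a]
| Gnp3_comm (a b : a_gen n) :
    #|a_supp a :&: a_supp b| < 2 -> Gnp3_rel [:: a; b; a; b]
| Gnp3_tetra (x y z v t : 'I_n) (eps : 'I_n -> bool) (a b c d : a_gen n) :
    uniq [:: x; y; z; v] ->
    t \in [set x; y; z; v] ->
    (forall s, s \in [set x; y; z; v] -> s <= t) ->
    \sum_(s in [set x; y; z; v] :\ t) eps s = 0 %[mod 2] ->
    val a = ([set x; y; z], eps v) ->
    val b = ([set x; y; v], eps z) ->
    val c = ([set x; z; v], eps y) ->
    val d = ([set y; z; v], eps x) ->
    Gnp3_rel [:: a; b; c; d; a; b; c; d].

Definition Gnp3 (n : nat) : groupType := presented (@Gnp3_rel n).

Definition Gnp3_eval n (beta : seq (a_gen n)) : Gnp3 n :=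
  pres_eval (@Gnp3_rel n) beta.

Section Fn3.
Variables (n : nat) (i j k : 'I_n).

Definition Fn3_gen : choiceType :=
  {ffun {l : 'I_n | l \notin [set i; j; k]} -> 'Z_2}.

Inductive Fn3_rel : seq Fn3_gen -> Prop :=
| Fn3_sq (sigma : Fn3_gen) : Fn3_rel [:: sigma; sigma].

Definition Fn3 : groupType := presented Fn3_rel.

(* N_{xyz}^delta, where u is the part of the word before the occurrence. *)
Definition occ (u : seq (a_gen n)) (x y z : 'I_n) (delta : bool) : nat :=
  count (fun c => val c == ([set x; y; z], delta)) u.

(* i^p_c(l), before reduction mod 2, for an occurrence c of a_{ijk}^eps preceded
   by u. *)
Definition ip_count (u : seq (a_gen n)) (eps : bool) (l : 'I_n) : nat :=
  match eps, k < l with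
  | false, true  => occ u i k l false + occ u j k l false + occ u i j l true
  | false, false => occ u i k l false + occ u j k l false
  | true,  true  => occ u i k l false + occ u j k l true + occ u i j l false
  | true,  false => occ u i k l false + occ u j k l true
  end.

Definition ip (u : seq (a_gen n)) (eps : bool) : Fn3_gen :=
  [ffun l => ((ip_count u eps (val l))%:R)%R].

(* The maps i^p_c, for the occurrences c of a_{ijk}^0 and a_{ijk}^1 in beta, from
   left to right, when beta is preceded by u. *)
Fixpoint ip_seq (u beta : seq (a_gen n)) : seq Fn3_gen :=
  if beta is c :: beta' then
    if a_supp c == [set i; j; k]
    then ip u (a_label c) :: ip_seq (rcons u c) beta'
    else ip_seq (rcons u c) beta'
  else [::].

Definition wp (beta : seq (a_gen n)) : Fn3 :=
  pres_eval Fn3_rel (ip_seq [::] beta).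

End Fn3.

(* Main.v *)
Require Import Defs.
From mathcomp Require Import all_boot.
From mathcomp Require Import zmodp.

Set Implicit Arguments.
Unset Strict Implicit.
Unset Printing Implicit Defensive.

(** The invariance is checked on the defining relations.  Every relator of
    [Gnp3] is a square [w ++ w], with [w] equal to [a], [ab] or [abcd], and the
    formal cancellation of a generator with its inverse becomes the deletion of
    a square [aa], because [wp] treats both as the same letter.

    The map [i^p_c] is additive in the prefix of [c], so a deleted square, whose
    letters come in pairs, does not change the maps of the letters that follow
    it ([ip_even_square], [ip_delete_even]).  It remains to see that the letters
    of the square contribute the identity.  In all three cases [w] has at most
    one letter [c] over [{i, j, k}], so the square contributes at most two
    letters of [Fn3]; they are equal, hence cancel, as soon as the whole of [w]
    contributes an even number to [i^p_c] ([wp_square]).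

    For [a] and [ab] that contribution is zero, since only triples that meet
    [{i, j, k}] in exactly two points are counted.  For [abcd] ([tetra_even]),
    the four letters are the facets [(S :\ s, eps s)] of a 4-element set [S], and
    [c] is the facet with [S :\ s = {i, j, k}].  At a point other than [s] nothing
    is counted.  At [s], the rule of [i^p_c] that applies gives, modulo 2,
    [eps i + eps j + eps k] if [k < s] and [eps i + eps j + eps s] if [s < k],
    whatever the label [eps s] is.  Since [k] exceeds [i] and [j], this is the sum
    of [eps] over [S] without its largest element, which is even by the condition
    in the relation. *)

Section Invariant.
Variables (n : nat) (i j k : 'I_n).

Local Notation ijk := [set i; j; k].

(** * Additivity in the prefix *)

Lemma ip_count_cat (u v : seq (a_gen n)) e l :
  ip_count i j k (u ++ v) e l = ip_count i j k u e l + ip_count i j k v e l.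
Proof.
rewrite /ip_count /occ !count_cat.
case: e; case: (k < l); rewrite [RHS]addnACA //; congr addn;
  by rewrite addnACA.
Qed.

(** When this holds, inserting [w] anywhere before an occurrence of [a_{ijk}^e]
    leaves the map of that occurrence unchanged. *)
Definition ip_even (w : seq (a_gen n)) (e : bool) : Prop :=
  forall l, l \notin ijk -> ~~ odd (ip_count i j k w e l).

Lemma ip_even_square w e : ip_even (w ++ w) e.
Proof. by move=> l _; rewrite ip_count_cat oddD addbb. Qed.

Lemma ip_delete_even u w v e :
  ip_even w e -> ip i j k (u ++ w ++ v) e = ip i j k (u ++ v) e.
Proof.
move=> w_even; apply/ffunP=> l; rewrite !ffunE !ip_count_cat.
have /negPf w0 := w_even _ (valP l).
apply/val_inj; rewrite /= !val_Zp_nat // !modn2 !oddD w0; congr nat_of_bool.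
Qed.

Lemma ip_seq_cat u v w :
  ip_seq i j k u (v ++ w) = ip_seq i j k u v ++ ip_seq i j k (u ++ v) w.
Proof.
elim: v u => [|c v IHv] u /=; first by rewrite cats0.
by rewrite IHv cat_rcons; case: ifP.
Qed.

Lemma size_ip_seq u w :
  size (ip_seq i j k u w) = count (fun c => a_supp c == ijk) w.
Proof. by elim: w u => //= c w IHw u; case: ifP => _ /=; rewrite IHw. Qed.

Lemma ip_seq_delete_even u w v :
    (forall c, c \in v -> a_supp c = ijk -> ip_even w (a_label c)) ->
  ip_seq i j k (u ++ w) v = ip_seq i j k u v.
Proof.
(* The letters of [v] already read accumulate in [t]. *)
suff gen t : (forall c, c \in v -> a_supp c = ijk -> ip_even w (a_label c)) ->
    ip_seq i j k (u ++ w ++ t) v = ip_seq i j k (u ++ t) v.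
  by move=> /gen-/(_ [::]); rewrite !cats0.
elim: v t => //= c v IHv t v_even.
have -> : ip_seq i j k (rcons (u ++ w ++ t) c) v
          = ip_seq i j k (rcons (u ++ t) c) v.
  rewrite !rcons_cat; apply: IHv => d dv; apply: v_even.
  by rewrite inE dv orbT.
case: eqP => // c_ijk; congr (_ :: _).
by apply: ip_delete_even; apply: v_even; rewrite ?mem_head.
Qed.

(** * Squares are invisible to the invariant *)

Lemma Fn3_gen_square (s : Fn3_gen i j k) :
  pres_eval (@Fn3_rel n i j k) [:: s; s] = 1%g.
Proof.
rewrite pres_evalE; apply/pres_classP.
exact: (pres_relator [::] [::] (Fn3_sq s)).
Qed.

(** The condition on [w] under which the square [w ++ w] contributes the identity
    of [Fn3].  With two letters over [{i, j, k}] the contribution would be a word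
    [s t s t], which is nontrivial in general. *)
Definition square_trivial (w : seq (a_gen n)) : Prop :=
  count (fun c => a_supp c == ijk) w <= 1 /\
  forall c, c \in w -> a_supp c = ijk -> ip_even w (a_label c).

(** The second copy of [w] yields the same letters of [Fn3] as the first, because
    the first copy shifts their prefix by an even amount; there is at most one such
    letter, so the two copies cancel.  The part after the square does not see it. *)
Lemma wp_square u w v : square_trivial w ->
  wp i j k (u ++ (w ++ w) ++ v) = wp i j k (u ++ v).
Proof.
move=> [w_le1 w_even]; rewrite /wp !ip_seq_cat /= /pres_eval !big_cat /=.
rewrite (@ip_seq_delete_even u (w ++ w)) => [|c _ _]; last exact: ip_even_square.
rewrite (ip_seq_delete_even u w_even).
move: w_le1; rewrite -(size_ip_seq u).
case: (ip_seq i j k u w) => [|s [|//]] _; first by rewrite !big_nil !mul1g.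
have := Fn3_gen_square s; rewrite /pres_eval !big_cons !big_nil !mulg1 => ->.
by rewrite mul1g.
Qed.

(** * The words underlying the relators *)

Hypothesis ijk_uniq : uniq [:: i; j; k].

Lemma card_ijk : #|ijk| = 3.
Proof.
rewrite -[3]/(size [:: i; j; k]) -(card_uniqP ijk_uniq).
by apply: eq_card => x; rewrite !inE orbA.
Qed.

(** A triple counted by [i^p_c] at [l] is [{x, y, l}] with [x], [y] distinct in
    [{i, j, k}], so it meets [{i, j, k}] in exactly two points. *)
Lemma ip_count_eq0 w e l : l \notin ijk ->
    (forall c, c \in w -> l \in a_supp c -> #|a_supp c :&: ijk| != 2) ->
  ip_count i j k w e l = 0.
Proof.
move=> lP w_no2; have occ0 x y d : x \in ijk -> y \in ijk -> x != y ->
    occ w x y l d = 0.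
  move=> xP yP x_y; apply/eqP; rewrite -leqn0 leqNgt -has_count.
  apply/hasP=> -[c cw /eqP c_xyl].
  have /w_no2 : c \in w by [].
  rewrite /a_supp c_xyl /= !inE eqxx orbT => /(_ isT)/eqP[].
  have -> : [set x; y; l] :&: ijk = [set x; y].
    rewrite setIUl; have -> : [set l] :&: ijk = set0.
      by apply/eqP; rewrite setI_eq0 disjoints1.
    rewrite setU0; apply/setIidPl/subsetP=> u.
    by rewrite in_set2 => /orP[]/eqP->.
  by rewrite cards2 x_y.
move: ijk_uniq; rewrite /= !inE negb_or !andbT => /andP[/andP[ij ik] jk].
rewrite /ip_count !occ0 ?inE ?eqxx ?orbT //.
by case: e; case: (k < l).
Qed.

Lemma square_trivial1 a : square_trivial [:: a].
Proof.
split=> [|c]; first by rewrite /= addn0 leq_b1.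
rewrite inE => /eqP-> a_ijk l lP; rewrite ip_count_eq0 // => c'.
by rewrite inE => /eqP->; rewrite a_ijk (negPf lP).
Qed.

Lemma square_trivial2 a b :
  #|a_supp a :&: a_supp b| < 2 -> square_trivial [:: a; b].
Proof.
move=> ab_lt2; split=> [|c].
  rewrite /= addn0; case: eqP => // a_ijk; case: eqP => // b_ijk.
  by move: ab_lt2; rewrite a_ijk b_ijk setIid card_ijk.
move=> c_ab c_ijk l lP; rewrite ip_count_eq0 // => d d_ab l_d.
have d_neq_c : d != c.
  by apply: contraNneq lP => d_c; rewrite -c_ijk -d_c.
rewrite -c_ijk; apply: contraTneq ab_lt2 => dc_2; rewrite -leqNgt -dc_2.
move: c_ab d_ab d_neq_c; rewrite !inE => /orP[]/eqP-> /orP[]/eqP->;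
  by rewrite ?eqxx // setIC.
Qed.

Lemma sum_set3 (x y z : 'I_n) (f : 'I_n -> nat) : uniq [:: x; y; z] ->
  \sum_(s in [set x; y; z]) f s = f x + f y + f z.
Proof.
move=> xyz_uniq; rewrite (eq_bigl (mem [:: x; y; z])) => [|s].
  by rewrite -big_uniq //= !big_cons big_nil addn0 addnA.
by rewrite !inE orbA.
Qed.

Lemma setD1_set4 (S : {set 'I_n}) x y z v :
  S = [set x; y; z; v] -> v \notin [set x; y; z] -> [set x; y; z] = S :\ v.
Proof. by move=> -> v_out; rewrite [_ :|: [set v]]setUC setU1K. Qed.

Lemma neq_sym2 (x y : 'I_n) :
  x != y -> ((x == y) = false) * ((y == x) = false).
Proof. by move=> /negPf xy; rewrite [y == x]eq_sym xy. Qed.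

(** A word [abcd] as in the tetrahedron relation is indexed by the vertices of [S],
    each generator by the vertex that its triple omits; the four letters are then
    treated alike. *)
Section Tetrahedron.
Variables (S : {set 'I_n}) (r : seq 'I_n) (eps : 'I_n -> bool).
Variables (w : seq (a_gen n)) (m : 'I_n).
Hypotheses (r_uniq : uniq r) (r_S : r =i S).
Hypothesis w_def : map val w = [seq (S :\ s, eps s) | s <- r].

Lemma count_facet (P : pred ({set 'I_n} * bool)) :
  count (fun c : a_gen n => P (val c)) w = count (fun s => P (S :\ s, eps s)) r.
Proof. by rewrite -[LHS](count_map val P) w_def count_map. Qed.

Lemma eq_facet s t : s \in S -> (S :\ s == S :\ t) = (s == t).
Proof.
move=> sS; apply/eqP/eqP=> [/setP/(_ s)|->//].
by rewrite !inE eqxx sS /= andbT => /esym/negbFE/eqP.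
Qed.

Lemma count_facet_at t (Q : pred bool) : t \in S ->
  count (fun s => (S :\ s == S :\ t) && Q (eps s)) r = Q (eps t).
Proof.
move=> tS; have tr : t \in r by rewrite r_S.
transitivity (count (fun s => (s == t) && Q (eps t)) r).
  apply: eq_in_count => s; rewrite r_S => sS; rewrite eq_facet //.
  by case: eqP => //= ->.
case: (Q _); last first.
  by rewrite (eq_count (a2 := pred0)) ?count_pred0 // => s; rewrite andbF.
rewrite (eq_count (a2 := pred1 t)) => [|s]; last by rewrite andbT.
by rewrite count_uniq_mem // tr.
Qed.

Lemma occ_facet t x y z e : t \in S -> [set x; y; z] = S :\ t ->
  occ w x y z e = (eps t == e).
Proof.
move=> tS xyz; rewrite /occ xyz (count_facet (pred1 _)).
by rewrite -(count_facet_at (pred1 e)).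
Qed.

Lemma occ_outside l x y z e : l \notin S -> l \in [set x; y; z] ->
  occ w x y z e = 0.
Proof.
move=> lS l_xyz; rewrite /occ (count_facet (pred1 _)).
rewrite (eq_count (a2 := pred0)) ?count_pred0 // => s /=.
apply/negP=> /eqP[xyz _]; move: l_xyz.
by rewrite -xyz !inE (negPf lS) andbF.
Qed.

Hypotheses (hik : i < k) (hjk : j < k).
Hypotheses (mS : m \in S) (m_max : forall s, s \in S -> s <= m).
Hypothesis eps_even : \sum_(s in S :\ m) eps s = 0 %[mod 2].

(** At the vertex [s], the facets opposite to [j], [i] and [k] are the triples
    [iks], [jks] and [ijs] counted by [i^p_c].  The largest vertex is [s] or [k],
    and the parity condition bears on [{i, j, k}] or [{i, j, s}] accordingly. *)
Lemma tetra_even s : s \in S -> S :\ s = ijk -> ip_even w (eps s).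
Proof.
move=> sS s_ijk l lP; have SE : S = s |: ijk by rewrite -s_ijk setD1K.
have s_out : s \notin ijk by rewrite -s_ijk !inE eqxx.
have [l_s | l_s] := eqVneq l s; last first.
  have lS : l \notin S by rewrite SE in_setU1 negb_or l_s.
  rewrite /ip_count !(@occ_outside l) ?inE ?eqxx ?orbT //.
  by case: (eps s); case: (k < l).
rewrite {l lP}l_s; move: ijk_uniq s_out.
rewrite /= !inE !negb_or !andbT => /andP[/andP[ij ik] jk] /andP[/andP[si sj] sk].
pose neqE := (neq_sym2 ij, neq_sym2 ik, neq_sym2 jk,
              neq_sym2 si, neq_sym2 sj, neq_sym2 sk).
have iks : [set i; k; s] = S :\ j.
  apply: setD1_set4; last by rewrite !inE !neqE.
  by rewrite SE; apply/setP=> u; rewrite !inE; do 4!case: (u == _).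
have jks : [set j; k; s] = S :\ i.
  apply: setD1_set4; last by rewrite !inE !neqE.
  by rewrite SE; apply/setP=> u; rewrite !inE; do 4!case: (u == _).
have ijs : [set i; j; s] = S :\ k.
  apply: setD1_set4; last by rewrite !inE !neqE.
  by rewrite SE; apply/setP=> u; rewrite !inE; do 4!case: (u == _).
have [iS jS kS] : [/\ i \in S, j \in S & k \in S].
  by rewrite SE !inE !eqxx ?orbT.
rewrite /ip_count !(occ_facet _ jS iks) !(occ_facet _ iS jks).
rewrite !(occ_facet _ kS ijs).
have mE : m = if k < s then s else k.
  apply/val_inj/eqP; rewrite eqn_leq.
  have := m_max sS; have := m_max kS; move: mS.
  rewrite SE !inE -!orbA => /or4P[]/eqP->.
  - by move=> k_le_s _; case: ltnP => [_|s_le_k]; rewrite ?leqnn // s_le_k k_le_s.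
  - by rewrite leqNgt hik.
  - by rewrite leqNgt hjk.
  - by move=> _ s_le_k; rewrite ltnNge s_le_k /= leqnn.
move: eps_even; rewrite mE; case: (k < s).
  rewrite s_ijk sum_set3 //.
  by case: (eps i); case: (eps j); case: (eps k); case: (eps s).
rewrite -ijs sum_set3; last by rewrite /= !inE !neqE.
by case: (eps i); case: (eps j); case: (eps s).
Qed.

Lemma square_trivial_tetra : square_trivial w.
Proof.
split=> [|c cw c_ijk].
  rewrite (count_facet (fun p => p.1 == ijk)) /=.
  have [/hasP[s sr /eqP s_ijk]|] := boolP (has (fun s => S :\ s == ijk) r);
      last first.
    by rewrite has_count -leqNgt => /leqW.
  rewrite -s_ijk.
  rewrite (eq_count (a2 := fun s' => (S :\ s' == S :\ s) && predT (eps s'))).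
    by rewrite count_facet_at -?r_S.
  by move=> s'; rewrite andbT.
have : val c \in map val w by apply: map_f.
rewrite w_def => /mapP[s sr c_s]; rewrite /a_label c_s.
by apply: tetra_even; rewrite -?r_S // -c_ijk /a_supp c_s.
Qed.

End Tetrahedron.

Lemma Gnp3_rel_square (hik : i < k) (hjk : j < k) r : Gnp3_rel r ->
  exists2 w, r = w ++ w & square_trivial w.
Proof.
case=> [a | a b ab | x y z v t eps a b c d xyzv_uniq tS t_max even va vb vc vd].
- by exists [:: a]; last apply: square_trivial1.
- by exists [:: a; b]; last apply: square_trivial2.
exists [:: a; b; c; d] => //.
(* [S] stays opaque, so that [:\] is not expanded into a test on each vertex. *)
have [S SE] : exists S, S = [set x; y; z; v] by exists [set x; y; z; v].
rewrite -SE in tS t_max even.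
apply: (square_trivial_tetra (S := S) (r := [:: v; z; y; x]) (eps := eps)
                             (m := t)) => //.
- by rewrite -(rev_uniq [:: x; y; z; v]) in xyzv_uniq.
- by move=> s; rewrite SE !inE; do 4!case: (s == _).
rewrite /= va vb vc vd; move: xyzv_uniq; rewrite /= !inE !negb_or !andbT.
move=> /and3P[/and3P[xy xz xv] /andP[yz yv] zv].
pose neqE := (neq_sym2 xy, neq_sym2 xz, neq_sym2 xv,
              neq_sym2 yz, neq_sym2 yv, neq_sym2 zv).
congr [:: (_, _); (_, _); (_, _); (_, _)]; apply: setD1_set4;
  rewrite ?inE ?neqE // SE; apply/setP=> s; rewrite !inE;
  by do 4!case: (s == _).
Qed.

Lemma wp_pres_eq (hik : i < k) (hjk : j < k) u v :
  pres_eq (@Gnp3_rel n) u v -> wp i j k (unzip1 u) = wp i j k (unzip1 v).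
Proof.
elim=> {u v} [// | u v _ -> // | u v w _ -> _ -> // | u v a b | u v r].
  rewrite /unzip1 !map_cat; exact: (wp_square _ _ (square_trivial1 a)).
move=> /(Gnp3_rel_square hik hjk)[w -> w_triv].
rewrite /unzip1 !map_cat -/(unzip1 _) -map_comp /comp /= map_id.
exact: wp_square.
Qed.

End Invariant.

Theorem lemma5p3 (n : nat) (hn : 3 <= n) (i j k : 'I_n)
    (hdistinct : uniq [:: i; j; k]) (hik : i < k) (hjk : j < k)
    (beta beta' : seq (a_gen n)) :
  Gnp3_eval beta = Gnp3_eval beta' ->
  wp i j k beta = wp i j k beta'.
Proof.
rewrite /Gnp3_eval !pres_evalE => /pres_classP/(wp_pres_eq hdistinct hik hjk).
by rewrite /unzip1 /pos_word -!map_comp /comp /= !map_id.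
Qed.
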